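(* Let $\mathcal{P}$ be one of the following three conditions on ring morphisms: PSI-morphism, strong PSI-morphism, epimorphism. Then an inductive limit of $\mathcal{P}$-morphisms is a $\mathcal{P}$-morphism. That is, if $\{u_i:A_i\to B_i\}_{i\in I}$ is an inductive system of ring morphisms such that every $u_i$ satisfies $\mathcal{P}$, then the limit morphism $u:\varinjlim A_i\to\varinjlim B_i$ satisfies $\mathcal{P}$.
   Context: All rings are commutative and unitary, and ring morphisms are unitary. An inductive system of ring morphisms is indexed by a (nonempty) directed set $I$: it consists of direct systems of rings $(A_i)_{i\in I}$, $(B_i)_{i\in I}$ and ring morphisms $u_i:A_i\to B_i$ compatible with the transition maps. For a ring morphism $u:A\to B$, a proper ideal $J$ of $B$ is called $A$-prime if $u(a)b\in J$ with $a\in A$ and $b\in B$ implies that $u(a)\in J$ or $b\in J$. The morphism $u$ is a PSI-morphism if every $A$-prime ideal of $B$ is a prime ideal of $B$. For $P\in\mathrm{Spec}(A)$, $k_A(P)=A_P/PA_P$ denotes the residue field of $A$ at $P$. The morphism $u$ is a strong PSI-morphism if for every $P\in\mathrm{Spec}(A)$ with $k_A(P)\otimes_A B\neq 0$, the canonical map $k_A(P)\to k_A(P)\otimes_A B$ is an isomorphism. The morphism $u$ is an epimorphism if the canonical multiplication map $B\otimes_A B\to B$ is an isomorphism. *)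

(* Defs.v *)
From HB Require Import structures.
From mathcomp Require Import all_boot all_order all_algebra ring.
From mathcomp Require Import boolp.

Set Implicit Arguments.
Unset Strict Implicit.
Unset Printing Implicit Defensive.

Import Order.TTheory GRing.Theory.

Local Open Scope ring_scope.
Local Open Scope quotient_scope.

(* Rings are [comPzRingType]s, so that the zero ring is allowed; the ideals of *)
(* ring_quotient ([idealr], [prime_idealr]) only exist over nonzero rings.     *)

Definition is_proper_ideal (B : comPzRingType) (J : {pred B}) : Prop :=
  [/\ 0 \in J, 1 \notin J & forall b, {in J &, forall x y, b * x + y \in J}].

Definition is_prime_ideal (B : comPzRingType) (J : {pred B}) : Prop :=
  is_proper_ideal J /\ forall x y, x * y \in J -> x \in J \/ y \in J.

Definition is_A_prime_ideal (A B : comPzRingType) (u : {rmorphism A -> B})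
    (J : {pred B}) : Prop :=
  is_proper_ideal J /\
  forall (a : A) (b : B), u a * b \in J -> u a \in J \/ b \in J.

Definition is_PSI (A B : comPzRingType) (u : {rmorphism A -> B}) : Prop :=
  forall J : {pred B}, is_A_prime_ideal u J -> is_prime_ideal J.

Record Spec (A : comPzRingType) := PrimeIdeal {
  prime_pred :> {pred A};
  prime_predP : is_prime_ideal prime_pred }.

Section Localization.
Variables (A : comPzRingType) (P : Spec A).

Lemma prime1 : 1 \notin P.
Proof. by case: (prime_predP P) => -[]. Qed.

Lemma prime0 : 0 \in P.
Proof. by case: (prime_predP P) => -[]. Qed.

Lemma primeD x y : x \in P -> y \in P -> x + y \in P.
Proof.
case: (prime_predP P) => -[_ _ hP] _ xP yP.
by rewrite -[x]mul1r hP.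
Qed.

Lemma primeMl a x : x \in P -> a * x \in P.
Proof.
case: (prime_predP P) => -[P0 _ hP] _ xP.
by rewrite -[_ * _]addr0 hP.
Qed.

Lemma primeCM s t : s \notin P -> t \notin P -> s * t \notin P.
Proof.
move=> sP tP; apply/negP; case: (prime_predP P) => _ hP /hP[].
  exact/negP.
exact/negP.
Qed.

Definition denominator := {s : A | s \notin P}.
HB.instance Definition _ := Choice.on denominator.

Definition denom1 : denominator := exist _ 1 prime1.
Definition denomM (s t : denominator) : denominator :=
  exist _ (sval s * sval t) (primeCM (svalP s) (svalP t)).

Definition frac_equiv (x y : A * denominator) : bool :=
  `[< exists2 t : A, t \notin P &
        t * (x.1 * sval y.2) = t * (y.1 * sval x.2) >].

Lemma frac_equiv_is_equiv : equiv_class_of frac_equiv.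
Proof.
split=> [x | x y | y x z].
- by apply/asboolP; exists 1; first exact: prime1.
- by apply/asboolP/asboolP => -[t tP e]; exists t.
move=> /asboolP[t tP e1] /asboolP[t' t'P e2]; apply/asboolP.
exists (t * t' * sval y.2); first by rewrite !primeCM // (svalP y.2).
transitivity (t' * sval z.2 * (t * (x.1 * sval y.2))); first by ring.
rewrite e1.
transitivity (t * sval x.2 * (t' * (y.1 * sval z.2))); first by ring.
rewrite e2; ring.
Qed.

Canonical frac_equivRel := EquivRelPack frac_equiv_is_equiv.
Canonical frac_encModRel := defaultEncModRel frac_equiv.

Definition localization := {eq_quot frac_equiv}.
HB.instance Definition _ := Choice.on localization.
HB.instance Definition _ : EqQuotient _ frac_equiv localization :=
  EqQuotient.on localization.

Lemma localizationP (x y : A * denominator) :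
  reflect (exists2 t : A, t \notin P &
             t * (x.1 * sval y.2) = t * (y.1 * sval x.2))
          (x == y %[mod localization]).
Proof. by rewrite eqmodE; exact: asboolP. Qed.

Lemma repr_localization (x : A * denominator) :
  exists2 t : A, t \notin P &
    t * ((repr (\pi_localization x)).1 * sval x.2) =
    t * (x.1 * sval (repr (\pi_localization x)).2).
Proof. by apply/localizationP; rewrite reprK. Qed.

Definition loc_addf (x y : A * denominator) : A * denominator :=
  (x.1 * sval y.2 + y.1 * sval x.2, denomM x.2 y.2).
Definition loc_oppf (x : A * denominator) : A * denominator := (- x.1, x.2).
Definition loc_mulf (x y : A * denominator) : A * denominator :=
  (x.1 * y.1, denomM x.2 y.2).

Definition loc_zero : localization := \pi_localization (0, denom1).
Definition loc_one : localization := \pi_localization (1, denom1).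
Definition loc_add := lift_op2 localization loc_addf.
Definition loc_opp := lift_op1 localization loc_oppf.
Definition loc_mul := lift_op2 localization loc_mulf.

Lemma pi_loc_add : {morph \pi : x y / loc_addf x y >-> loc_add x y}.
Proof.
move=> x y; unlock loc_add; symmetry; apply/eqP/localizationP => /=.
have [t tP ex] := repr_localization x; have [t' t'P ey] := repr_localization y.
exists (t * t'); first exact: primeCM.
set x' := repr _ in ex *; set y' := repr _ in ey *.
transitivity
  (t * (x'.1 * sval x.2) * (t' * (sval y'.2 * sval y.2))
   + t' * (y'.1 * sval y.2) * (t * (sval x'.2 * sval x.2))); first by ring.
by rewrite ex ey; ring.
Qed.

Lemma pi_loc_opp : {morph \pi : x / loc_oppf x >-> loc_opp x}.
Proof.
move=> x; unlock loc_opp; symmetry; apply/eqP/localizationP => /=.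
have [t tP ex] := repr_localization x; exists t => //.
by rewrite !mulNr !mulrN ex.
Qed.

Lemma pi_loc_mul : {morph \pi : x y / loc_mulf x y >-> loc_mul x y}.
Proof.
move=> x y; unlock loc_mul; symmetry; apply/eqP/localizationP => /=.
have [t tP ex] := repr_localization x; have [t' t'P ey] := repr_localization y.
exists (t * t'); first exact: primeCM.
set x' := repr _ in ex *; set y' := repr _ in ey *.
transitivity (t * (x'.1 * sval x.2) * (t' * (y'.1 * sval y.2))); first by ring.
by rewrite ex ey; ring.
Qed.

Lemma eq_pi_loc (x y : A * denominator) :
  x.1 * sval y.2 = y.1 * sval x.2 -> \pi_localization x = \pi_localization y.
Proof.
move=> e; apply/eqP/localizationP.
by exists 1; [exact: prime1 | rewrite e].
Qed.

Lemma loc_addA : associative loc_add.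
Proof.
elim/quotW=> x; elim/quotW=> y; elim/quotW=> z; rewrite -!pi_loc_add.
by apply: eq_pi_loc => /=; ring.
Qed.

Lemma loc_addC : commutative loc_add.
Proof.
elim/quotW=> x; elim/quotW=> y; rewrite -!pi_loc_add.
by apply: eq_pi_loc => /=; ring.
Qed.

Lemma loc_add0 : left_id loc_zero loc_add.
Proof.
elim/quotW=> x; rewrite -!pi_loc_add; apply: eq_pi_loc => /=; ring.
Qed.

Lemma loc_addN : left_inverse loc_zero loc_opp loc_add.
Proof.
elim/quotW=> x; rewrite -pi_loc_opp -!pi_loc_add; apply: eq_pi_loc => /=; ring.
Qed.

HB.instance Definition _ :=
  GRing.isZmodule.Build localization loc_addA loc_addC loc_add0 loc_addN.

Lemma loc_mulA : associative loc_mul.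
Proof.
elim/quotW=> x; elim/quotW=> y; elim/quotW=> z; rewrite -!pi_loc_mul.
by apply: eq_pi_loc => /=; ring.
Qed.

Lemma loc_mulC : commutative loc_mul.
Proof.
elim/quotW=> x; elim/quotW=> y; rewrite -!pi_loc_mul.
by apply: eq_pi_loc => /=; ring.
Qed.

Lemma loc_mul1 : left_id loc_one loc_mul.
Proof.
elim/quotW=> x; rewrite -!pi_loc_mul; apply: eq_pi_loc => /=; ring.
Qed.

Lemma loc_mulD : left_distributive loc_mul loc_add.
Proof.
elim/quotW=> x; elim/quotW=> y; elim/quotW=> z.
rewrite -!pi_loc_add -!pi_loc_mul -!pi_loc_add.
by apply: eq_pi_loc => /=; ring.
Qed.

Lemma loc_one_neq0 : loc_one != 0.
Proof.
apply/negP => /localizationP /= [t tP].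
by rewrite mulr1 mul0r mulr1 mulr0 => t0; rewrite t0 prime0 in tP.
Qed.

HB.instance Definition _ := GRing.Zmodule_isComNzRing.Build localization
  loc_mulA loc_mulC loc_mul1 loc_mulD loc_one_neq0.

Definition to_localization (a : A) : localization := \pi_localization (a, denom1).

Lemma to_localization_is_zmod_morphism : zmod_morphism to_localization.
Proof.
move=> a b; rewrite /to_localization.
rewrite -[RHS]/(loc_add _ (loc_opp _)) -pi_loc_opp -pi_loc_add.
by apply: eq_pi_loc => /=; ring.
Qed.

Lemma to_localization_is_monoid_morphism : monoid_morphism to_localization.
Proof.
split=> // a b; rewrite /to_localization -[RHS]/(loc_mul _ _) -pi_loc_mul.
by apply: eq_pi_loc => /=; ring.
Qed.

HB.instance Definition _ := GRing.isZmodMorphism.Build A localization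
  to_localization to_localization_is_zmod_morphism.
HB.instance Definition _ := GRing.isMonoidMorphism.Build A localization
  to_localization to_localization_is_monoid_morphism.

(* The ideal PA_P: the fractions a / s with a in P. *)
Definition max_ideal (z : localization) : bool :=
  `[< exists x : A * denominator, x.1 \in P /\ z = \pi_localization x >].

Lemma max_ideal_closed : idealr_closed max_ideal.
Proof.
split=> [||z].
- by apply/asboolP; exists (0, denom1); split; first exact: prime0.
- apply/negP => /asboolP[x [xP]] /eqP /localizationP /= [t tP].
  rewrite mulr1 mul1r => e.
  by have := primeCM tP (svalP x.2); rewrite e primeMl.
elim/quotW: z => x _ _ /asboolP[y [yP ->]] /asboolP[z [zP ->]].
apply/asboolP; exists (loc_addf (loc_mulf x y) z); split; last first.
  by rewrite pi_loc_add pi_loc_mul.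
by apply: primeD; [rewrite /= mulrAC primeMl | rewrite mulrC primeMl].
Qed.

HB.instance Definition _ := isIdealr.Build localization max_ideal
  max_ideal_closed.

Definition residue_field : comPzRingType :=
  {ideal_quot (max_ideal : idealr localization)}.

Definition to_residue_field : {rmorphism A -> residue_field} :=
  \pi_{ideal_quot (max_ideal : idealr localization)} \o to_localization.

End Localization.

(* In C (x)_A B, a sequence of pairs stands for the sum of the pure tensors    *)
(* x.1 (x) x.2.  Negative coefficients are not needed, as                      *)
(* - (c (x) b) = (- c) (x) b.                                                  *)
Section TensorProduct.
Variables (A C B : comPzRingType).
Variables (f : {rmorphism A -> C}) (g : {rmorphism A -> B}).

Inductive tensor_rel : seq (C * B) -> seq (C * B) -> Prop :=
| tensor_perm s t : perm_eq s t -> tensor_rel s t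
| tensor_sym s t : tensor_rel s t -> tensor_rel t s
| tensor_trans s t r : tensor_rel s t -> tensor_rel t r -> tensor_rel s r
| tensor_cat s s' t t' :
    tensor_rel s s' -> tensor_rel t t' -> tensor_rel (s ++ t) (s' ++ t')
| tensor_rel0 b : tensor_rel [:: (0, b)] [::]
| tensor_relDl c c' b : tensor_rel [:: (c + c', b)] [:: (c, b); (c', b)]
| tensor_relDr c b b' : tensor_rel [:: (c, b + b')] [:: (c, b); (c, b')]
| tensor_relM c a b : tensor_rel [:: (c * f a, b)] [:: (c, g a * b)].

Definition tensor_equiv (s t : seq (C * B)) : bool := `[< tensor_rel s t >].

Lemma tensor_equiv_is_equiv : equiv_class_of tensor_equiv.
Proof.
split=> [s | s t | t s r]; first exact/asboolP/tensor_perm.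
  by apply/asboolP/asboolP; exact: tensor_sym.
by move=> /asboolP st /asboolP tr; exact/asboolP/(tensor_trans st tr).
Qed.

Canonical tensor_equivRel := EquivRelPack tensor_equiv_is_equiv.
Canonical tensor_encModRel := defaultEncModRel tensor_equiv.

Definition tensor := {eq_quot tensor_equiv}.
HB.instance Definition _ := Choice.on tensor.
HB.instance Definition _ : EqQuotient _ tensor_equiv tensor :=
  EqQuotient.on tensor.

Lemma tensorP (s t : seq (C * B)) :
  reflect (tensor_rel s t) (s == t %[mod tensor]).
Proof. by rewrite eqmodE; exact: asboolP. Qed.

Lemma repr_tensor (s : seq (C * B)) : tensor_rel (repr (\pi_tensor s)) s.
Proof. by apply/tensorP; rewrite reprK. Qed.

Definition tens_addf (s t : seq (C * B)) := s ++ t.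
Definition tens_oppf (s : seq (C * B)) := [seq (- x.1, x.2) | x <- s].
Definition tens_mulf (s t : seq (C * B)) :=
  [seq (x.1 * y.1, x.2 * y.2) | x <- s, y <- t].

Definition tens_zero : tensor := \pi_tensor [::].
Definition tens_one : tensor := \pi_tensor [:: (1, 1)].
Definition tens_add := lift_op2 tensor tens_addf.
Definition tens_opp := lift_op1 tensor tens_oppf.
Definition tens_mul := lift_op2 tensor tens_mulf.

Lemma pi_tens_add : {morph \pi : s t / tens_addf s t >-> tens_add s t}.
Proof.
move=> s t; unlock tens_add; symmetry; apply/eqP/tensorP.
by apply: tensor_cat; exact: repr_tensor.
Qed.

Lemma tens_opp_rel s t : tensor_rel s t -> tensor_rel (tens_oppf s) (tens_oppf t).
Proof.
elim=> {s t} [s t st|s t _ |s t r _ st _|s s' t t' _ ss' _ tt'|b|c c' b|c b b'|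
  c a b] /=.
- exact/tensor_perm/perm_map.
- exact: tensor_sym.
- exact: tensor_trans.
- by rewrite /tens_oppf !map_cat; exact: tensor_cat.
- by rewrite oppr0; exact: tensor_rel0.
- by rewrite opprD; exact: tensor_relDl.
- exact: tensor_relDr.
- by rewrite -mulNr; exact: tensor_relM.
Qed.

Lemma pi_tens_opp : {morph \pi : s / tens_oppf s >-> tens_opp s}.
Proof.
move=> s; unlock tens_opp; symmetry; apply/eqP/tensorP.
exact/tens_opp_rel/repr_tensor.
Qed.

Lemma tens_mulf_consr s y t :
  perm_eq (tens_mulf s (y :: t))
          ([seq (x.1 * y.1, x.2 * y.2) | x <- s] ++ tens_mulf s t).
Proof.
exact/permPl/(perm_allpairs_consr (fun x y : C * B => (x.1 * y.1, x.2 * y.2)) s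
  (fun=> y) (fun=> t)).
Qed.

Lemma tens_mulfC s t : perm_eq (tens_mulf s t) (tens_mulf t s).
Proof.
elim: s t => [|x s IHs] t; first by rewrite /tens_mulf; elim: t.
apply: perm_trans (_ : perm_eq ([seq (y.1 * x.1, y.2 * x.2) | y <- t] ++
  tens_mulf t s) _); last by rewrite perm_sym tens_mulf_consr.
apply: perm_cat; last exact: IHs.
have /eq_map -> // : (fun y : C * B => (x.1 * y.1, x.2 * y.2)) =1
                     (fun y => (y.1 * x.1, y.2 * x.2)).
by move=> y; rewrite mulrC [x.2 * _]mulrC.
Qed.

Lemma tens_mul_rel_simple s s' t :
    (forall y : C * B, tensor_rel [seq (x.1 * y.1, x.2 * y.2) | x <- s]
                                  [seq (x.1 * y.1, x.2 * y.2) | x <- s']) ->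
  tensor_rel (tens_mulf s t) (tens_mulf s' t).
Proof.
move=> ss'; elim: t => [|y t IHt].
  by rewrite /tens_mulf !allpairs0r; exact: tensor_perm.
apply: tensor_trans (tensor_perm (tens_mulf_consr _ _ _)) _.
apply: tensor_trans (tensor_cat (ss' y) IHt) _.
by apply/tensor_sym/tensor_perm/tens_mulf_consr.
Qed.

Lemma tens_mul_rell s s' t :
  tensor_rel s s' -> tensor_rel (tens_mulf s t) (tens_mulf s' t).
Proof.
elim=> {s s'} [s s' ss'|s s' _ |s s' r _ ss' _|s s' r r' _ ss' _ rr'|b|c c' b|
  c b b'|c a b] /=.
- exact/tensor_perm/perm_allpairs.
- exact: tensor_sym.
- exact: tensor_trans.
- by rewrite /tens_mulf !allpairs_cat; exact: tensor_cat.
- by apply: tens_mul_rel_simple => y /=; rewrite mul0r; exact: tensor_rel0.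
- by apply: tens_mul_rel_simple => y /=; rewrite mulrDl; exact: tensor_relDl.
- by apply: tens_mul_rel_simple => y /=; rewrite mulrDl; exact: tensor_relDr.
- apply: tens_mul_rel_simple => y /=.
  by rewrite mulrAC -[g a * _ * _]mulrA; exact: tensor_relM.
Qed.

Lemma pi_tens_mul : {morph \pi : s t / tens_mulf s t >-> tens_mul s t}.
Proof.
move=> s t; unlock tens_mul; symmetry; apply/eqP/tensorP.
apply: tensor_trans (tens_mul_rell _ (repr_tensor s)) _.
apply: tensor_trans (tensor_perm (tens_mulfC _ _)) _.
apply: tensor_trans (tens_mul_rell _ (repr_tensor t)) _.
exact/tensor_perm/tens_mulfC.
Qed.

Lemma eq_pi_tensor s t : tensor_rel s t -> \pi_tensor s = \pi_tensor t.
Proof. by move=> /tensorP/eqP. Qed.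

Lemma tens_addA : associative tens_add.
Proof.
elim/quotW=> x; elim/quotW=> y; elim/quotW=> z; rewrite -!pi_tens_add.
by rewrite /tens_addf catA.
Qed.

Lemma tens_addC : commutative tens_add.
Proof.
elim/quotW=> x; elim/quotW=> y; rewrite -!pi_tens_add.
by apply: eq_pi_tensor; apply: tensor_perm; rewrite /tens_addf perm_catC.
Qed.

Lemma tens_add0 : left_id tens_zero tens_add.
Proof. by elim/quotW=> x; rewrite -!pi_tens_add. Qed.

Lemma tens_addN : left_inverse tens_zero tens_opp tens_add.
Proof.
elim/quotW=> s; rewrite -pi_tens_opp -!pi_tens_add; apply: eq_pi_tensor.
rewrite /tens_addf; elim: s => [|[c b] s IHs]; first exact: tensor_perm.
apply: (@tensor_trans _ ([:: (- c, b); (c, b)] ++ (tens_oppf s ++ s))).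
  apply: tensor_perm; rewrite /= perm_cons.
  by rewrite -cat1s perm_catCA.
apply: (@tensor_trans _ ([::] ++ [::])); last exact: tensor_perm.
apply: tensor_cat => //.
apply: tensor_trans (tensor_sym (tensor_relDl _ _ _)) _.
by rewrite addNr; exact: tensor_rel0.
Qed.

HB.instance Definition _ :=
  GRing.isZmodule.Build tensor tens_addA tens_addC tens_add0 tens_addN.

Lemma tens_mulA : associative tens_mul.
Proof.
elim/quotW=> s; elim/quotW=> t; elim/quotW=> r; rewrite -!pi_tens_mul.
congr \pi; elim: s => //= x s IHs.
transitivity (tens_mulf [seq (x.1 * y.1, x.2 * y.2) | y <- t] r
              ++ tens_mulf (tens_mulf s t) r); last first.
  by rewrite /tens_mulf -allpairs_cat.
rewrite -IHs /=; congr (_ ++ _); rewrite /tens_mulf.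
elim: t {IHs} => //= y t IHt; rewrite map_cat IHt; congr (_ ++ _).
by rewrite -map_comp; apply: eq_map => z /=; rewrite !mulrA.
Qed.

Lemma tens_mulC : commutative tens_mul.
Proof.
elim/quotW=> x; elim/quotW=> y; rewrite -!pi_tens_mul.
exact/eq_pi_tensor/tensor_perm/tens_mulfC.
Qed.

Lemma tens_mul1 : left_id tens_one tens_mul.
Proof.
elim/quotW=> s; rewrite -!pi_tens_mul; congr \pi.
rewrite /tens_mulf /= cats0 -[RHS]map_id; apply: eq_map => -[c b] /=.
by rewrite !mul1r.
Qed.

Lemma tens_mulD : left_distributive tens_mul tens_add.
Proof.
elim/quotW=> x; elim/quotW=> y; elim/quotW=> z.
rewrite -!pi_tens_add -!pi_tens_mul -!pi_tens_add.
by rewrite /tens_mulf allpairs_cat.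
Qed.

HB.instance Definition _ := GRing.Zmodule_isComPzRing.Build tensor
  tens_mulA tens_mulC tens_mul1 tens_mulD.

Definition pure_tensor (c : C) (b : B) : tensor := \pi_tensor [:: (c, b)].

Definition tensor_inl (c : C) : tensor := pure_tensor c 1.

Lemma tensor_inl_is_zmod_morphism : zmod_morphism tensor_inl.
Proof.
move=> c c'; rewrite /tensor_inl /pure_tensor.
rewrite -[RHS]/(tens_add _ (tens_opp _)) -pi_tens_opp -pi_tens_add.
exact/eq_pi_tensor/tensor_relDl.
Qed.

Lemma tensor_inl_is_monoid_morphism : monoid_morphism tensor_inl.
Proof.
split=> // c c'; rewrite /tensor_inl /pure_tensor.
by rewrite -[RHS]/(tens_mul _ _) -pi_tens_mul /tens_mulf /= mulr1.
Qed.

HB.instance Definition _ := GRing.isZmodMorphism.Build C tensor tensor_inl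
  tensor_inl_is_zmod_morphism.
HB.instance Definition _ := GRing.isMonoidMorphism.Build C tensor tensor_inl
  tensor_inl_is_monoid_morphism.

End TensorProduct.

Section Multiplication.
Variables (A B : comPzRingType) (u : {rmorphism A -> B}).

Definition tensor_mult (z : tensor u u) : B := \sum_(x <- repr z) x.1 * x.2.

Lemma tensor_rel_sum s t : tensor_rel u u s t ->
  \sum_(x <- s) x.1 * x.2 = \sum_(x <- t) x.1 * x.2.
Proof.
elim=> {s t} [s t st|s t _ ->|s t r _ -> _ ->|s s' t t' _ e _ e'|b|c c' b|
  c b b'|c a b] //.
- exact: perm_big.
- by rewrite !big_cat /= e e'.
- by rewrite big_seq1 big_nil mul0r.
- by rewrite !big_cons !big_nil /= !addr0 mulrDl.
- by rewrite !big_cons !big_nil /= !addr0 mulrDr.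
- by rewrite !big_seq1 /= mulrA.
Qed.

Lemma tensor_mult_pi s :
  tensor_mult (\pi_(tensor u u) s) = \sum_(x <- s) x.1 * x.2.
Proof. exact/tensor_rel_sum/repr_tensor. Qed.

Lemma tensor_mult_is_zmod_morphism : zmod_morphism tensor_mult.
Proof.
elim/quotW=> s; elim/quotW=> t.
rewrite -[X in tensor_mult X]/(tens_add _ (tens_opp _)) -pi_tens_opp -pi_tens_add.
rewrite !tensor_mult_pi big_cat /= big_map -sumrN; congr (_ + _).
by apply: eq_bigr => x _; rewrite mulNr.
Qed.

Lemma tensor_mult_is_monoid_morphism : monoid_morphism tensor_mult.
Proof.
split; first by rewrite tensor_mult_pi big_seq1 mulr1.
elim/quotW=> s; elim/quotW=> t.
rewrite -[X in tensor_mult X]/(tens_mul _ _) -pi_tens_mul !tensor_mult_pi.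
rewrite big_allpairs_dep big_distrl; apply: eq_bigr => x _ /=.
by rewrite big_distrr; apply: eq_bigr => y _; rewrite /= mulrACA.
Qed.

HB.instance Definition _ := GRing.isZmodMorphism.Build (tensor u u) B
  tensor_mult tensor_mult_is_zmod_morphism.
HB.instance Definition _ := GRing.isMonoidMorphism.Build (tensor u u) B
  tensor_mult tensor_mult_is_monoid_morphism.

End Multiplication.

(* The inverse of a bijective ring morphism is a ring morphism. *)
Definition is_ring_iso (A B : comPzRingType) (u : {rmorphism A -> B}) : Prop :=
  bijective u.

Definition is_epimorphism (A B : comPzRingType) (u : {rmorphism A -> B}) : Prop :=
  is_ring_iso (tensor_mult (u := u)).

Definition is_strong_PSI (A B : comPzRingType) (u : {rmorphism A -> B}) : Prop :=
  forall P : Spec A, (1 : tensor (to_residue_field P) u) != 0 ->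
    is_ring_iso (tensor_inl (to_residue_field P) u).

Section InductiveSystems.
Variables (d : Order.disp_t) (I : preorderType d).
Local Open Scope order_scope.

Definition is_directed : Prop :=
  inhabited I /\ forall i j : I, exists2 k : I, i <= k & j <= k.

Record ring_system := RingSystem {
  system_ring :> I -> comPzRingType;
  transition : forall i j : I, i <= j ->
    {rmorphism system_ring i -> system_ring j};
  transition_id : forall i (le_ii : i <= i) x, transition le_ii x = x;
  transition_comp : forall i j k (le_ij : i <= j) (le_jk : j <= k)
      (le_ik : i <= k) x,
    transition le_ik x = transition le_jk (transition le_ij x) }.

Definition is_system_morphism (A B : ring_system)
    (u : forall i, {rmorphism A i -> B i}) : Prop :=
  forall i j (le_ij : i <= j) x,
    u j (transition A le_ij x) = transition B le_ij (u i x).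

Definition is_cocone (A : ring_system) (L : comPzRingType)
    (phi : forall i, {rmorphism A i -> L}) : Prop :=
  forall i j (le_ij : i <= j) x, phi j (transition A le_ij x) = phi i x.

Definition is_inductive_limit (A : ring_system) (L : comPzRingType)
    (phi : forall i, {rmorphism A i -> L}) : Prop :=
  is_cocone phi /\
  forall (C : comPzRingType) (psi : forall i, {rmorphism A i -> C}),
    is_cocone psi ->
    exists h : {rmorphism L -> C},
      (forall i x, h (phi i x) = psi i x) /\
      forall h' : {rmorphism L -> C},
        (forall i x, h' (phi i x) = psi i x) -> h' =1 h.

(* By the universal property of L, there is exactly one such v. *)
Definition is_limit_morphism (A B : ring_system)
    (u : forall i, {rmorphism A i -> B i})
    (L M : comPzRingType) (phi : forall i, {rmorphism A i -> L})
    (psi : forall i, {rmorphism B i -> M}) (v : {rmorphism L -> M}) : Prop :=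
  forall i x, v (phi i x) = psi i (u i x).

End InductiveSystems.

(* Main.v *)
Require Import Defs.
From HB Require Import structures.
From mathcomp Require Import all_boot all_order all_algebra.
From mathcomp Require Import boolp.

Set Implicit Arguments.
Unset Strict Implicit.
Unset Printing Implicit Defensive.

Import Order.TTheory GRing.Theory.
Local Open Scope ring_scope.
Local Open Scope quotient_scope.

(** Every element of the limit M comes from a stage B_i: the union of the
    images of the B_i is a subring of M, and the universal property makes the
    inclusion of that subring split, hence surjective ([limit_covered]). It
    then suffices to express each of the three conditions through statements
    on finitely many elements of M, and to move them between a stage and the
    limit along the morphisms from A_i and B_i.

    PSI: an L-prime ideal of M contracts to an A_i-prime, hence prime, ideal
    of each B_i; two elements of M live on a common stage, where primality of
    the contraction can be tested.

    Epimorphism: u : A -> B is an epimorphism exactly when b (x) 1 = 1 (x) b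
    for all b in B ([is_epimorphismP]), and such an equality at stage i maps
    to its analogue in M (x)_L M.

    Strong PSI: let P be a prime of L with k(P) (x)_L M nonzero, and P_i its
    contraction to A_i. The morphism k(P_i) -> k(P) ([residue_map]) induces a
    unitary morphism k(P_i) (x) B_i -> k(P) (x) M ([pi_tensor_map]), so the
    former ring is nonzero and k(P_i) -> k(P_i) (x) B_i is an isomorphism. For
    b in B_i this gives c in k(P_i) with c (x) 1 = 1 (x) b; its image in k(P)
    does the same for the image of b in M. Since the 1 (x) m span
    k(P) (x) M over k(P) ([tensor_inl_surj]), k(P) -> k(P) (x) M is surjective;
    it is injective because k(P) is a field ([residue_field_inv]) and the
    target is nonzero. *)

Lemma bijective_of_inj_surj (T U : Type) (f : T -> U) :
  injective f -> (forall y, exists x, f x = y) -> bijective f.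
Proof.
move=> f_inj /choice[g gK]; exists g => // x.
by apply: f_inj; rewrite gK.
Qed.

(** * Prime ideals and residue fields *)

Section Contraction.
Variables (A B : comPzRingType) (f : {rmorphism A -> B}).

Lemma proper_ideal_preim (J : {pred B}) :
  is_proper_ideal J -> is_proper_ideal [pred x | f x \in J].
Proof.
case=> J0 J1 JD; split; rewrite ?inE ?rmorph0 ?rmorph1 // => b x y.
by rewrite !inE rmorphD rmorphM; exact: JD.
Qed.

Lemma prime_ideal_preim (J : {pred B}) :
  is_prime_ideal J -> is_prime_ideal [pred x | f x \in J].
Proof.
case=> /proper_ideal_preim Jproper Jprime; split=> // x y.
by rewrite !inE rmorphM; exact: Jprime.
Qed.

Definition Spec_map (P : Spec B) : Spec A :=
  PrimeIdeal (prime_ideal_preim (prime_predP P)).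

End Contraction.

Section ResidueField.
Variables (A : comPzRingType) (P : Spec A).

(** The class in k(P) of the fraction x.1 / x.2. *)
Definition residue_frac (x : A * denominator P) : residue_field P :=
  \pi_{ideal_quot (max_ideal (P := P) : idealr (localization P))}
    (\pi_(localization P) x).

Lemma residue_frac_surj z : exists x, residue_frac x = z.
Proof.
by elim/quotW: z => w; elim/quotW: w => x; exists x.
Qed.

(** A fraction a / s lies in the maximal ideal only if its numerator is in P:
    if a / s = p / r with p in P, then t a r = t p s is in P for some t outside
    P, and neither t nor r is in P. *)
Lemma residue_frac_eq0 x : residue_frac x = 0 <-> x.1 \in P.
Proof.
pose w := \pi_(localization P) x.
pose m : idealr (localization P) := max_ideal (P := P).
have w_m : (w \in m) = (residue_frac x == 0).
  rewrite -[w in LHS]subr0 (Quotient.idealrBE m).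
  by congr (_ == _); exact: (rmorph0 \pi_{ideal_quot m}).
split=> [/eqP|xP]; last first.
  by apply/eqP; rewrite -w_m; apply/asboolP; exists x.
rewrite -w_m => /asboolP[p [pP /eqP/localizationP[t tP e]]].
apply: contraT => xP.
have := primeCM tP (primeCM xP (svalP p.2)).
by rewrite e mulrA mulrAC primeMl.
Qed.

Lemma residue_frac_sub x y : residue_frac x - residue_frac y =
  residue_frac (x.1 * sval y.2 - y.1 * sval x.2, denomM x.2 y.2).
Proof.
rewrite /residue_frac -[LHS]rmorphB; congr (\pi _).
rewrite -[LHS]/(loc_add _ (loc_opp _)) -pi_loc_opp -pi_loc_add.
by rewrite /loc_addf /= mulNr.
Qed.

Lemma residue_frac_eq x y : residue_frac x = residue_frac y <->
  x.1 * sval y.2 - y.1 * sval x.2 \in P.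
Proof.
rewrite -(residue_frac_eq0 (_, denomM x.2 y.2)) -residue_frac_sub.
by split=> [->|/subr0_eq]; rewrite ?subrr.
Qed.

Lemma residue_frac_mul x y : residue_frac x * residue_frac y =
  residue_frac (x.1 * y.1, denomM x.2 y.2).
Proof.
rewrite /residue_frac -[LHS]rmorphM; congr (\pi _).
by rewrite -[LHS]/(loc_mul _ _) -pi_loc_mul.
Qed.

Lemma residue_frac1 : residue_frac (1, denom1 P) = 1.
Proof. by rewrite -(rmorph1 (to_residue_field P)). Qed.

Lemma residue_field_inv (z : residue_field P) : z != 0 -> exists w, z * w = 1.
Proof.
have [[a s] <-] := residue_frac_surj z => /eqP z_neq0.
have aP : a \notin P.
  by apply/negP => aP; apply/z_neq0/residue_frac_eq0.
exists (residue_frac (sval s, exist _ a aP)).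
rewrite residue_frac_mul -residue_frac1; apply/residue_frac_eq => /=.
by rewrite mulr1 mul1r mulrC subrr prime0.
Qed.

End ResidueField.

Section ResidueMap.
Variables (A A' : comPzRingType) (f : {rmorphism A -> A'}) (P : Spec A').
Let Q := Spec_map f P.

Definition denominator_map (s : denominator Q) : denominator P :=
  exist _ (f (sval s)) (svalP s).

Definition frac_map (x : A * denominator Q) : A' * denominator P :=
  (f x.1, denominator_map x.2).

(** The morphism k(Q) -> k(P) of residue fields induced by f. It is computed on
    a chosen fraction; [residue_map_frac] shows that the choice does not
    matter. *)
Definition residue_map (z : residue_field Q) : residue_field P :=
  residue_frac (frac_map (sval (cid (residue_frac_surj z)))).

(** Independence of the fraction: f maps Q = f^-1(P) into P, so it preserves
    equality of cross products modulo the prime ideals. *)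
Lemma residue_map_frac x :
  residue_map (residue_frac x) = residue_frac (frac_map x).
Proof.
rewrite /residue_map; case: cid => y /= /residue_frac_eq.
by rewrite inE rmorphB !rmorphM => yx; apply/residue_frac_eq.
Qed.

Lemma residue_map_is_zmod_morphism : zmod_morphism residue_map.
Proof.
move=> z w; have [x <-] := residue_frac_surj z.
have [y <-] := residue_frac_surj w.
rewrite residue_frac_sub !residue_map_frac residue_frac_sub.
by apply/residue_frac_eq; rewrite /= !(rmorphB, rmorphM) subrr prime0.
Qed.

Lemma residue_map_is_monoid_morphism : monoid_morphism residue_map.
Proof.
split=> [|z w].
  rewrite -!residue_frac1 residue_map_frac; apply/residue_frac_eq.
  by rewrite /= !rmorph1 subrr prime0.
have [x <-] := residue_frac_surj z; have [y <-] := residue_frac_surj w.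
rewrite residue_frac_mul !residue_map_frac residue_frac_mul.
by apply/residue_frac_eq; rewrite /= !rmorphM subrr prime0.
Qed.

HB.instance Definition _ := GRing.isZmodMorphism.Build
  (residue_field Q) (residue_field P) residue_map residue_map_is_zmod_morphism.
HB.instance Definition _ := GRing.isMonoidMorphism.Build
  (residue_field Q) (residue_field P) residue_map
  residue_map_is_monoid_morphism.

Lemma residue_map_to_residue_field a :
  residue_map (to_residue_field Q a) = to_residue_field P (f a).
Proof.
rewrite -[to_residue_field Q a]/(residue_frac (a, denom1 Q)) residue_map_frac.
by apply/residue_frac_eq; rewrite /= rmorph1 subrr prime0.
Qed.

End ResidueMap.

(** * Tensor products *)

Section TensorMap.
Variables (A C B : comPzRingType).
Variables (f : {rmorphism A -> C}) (g : {rmorphism A -> B}).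
Variables (A' C' B' : comPzRingType).
Variables (f' : {rmorphism A' -> C'}) (g' : {rmorphism A' -> B'}).
Variables (al : {rmorphism A -> A'}) (ga : {rmorphism C -> C'}).
Variables (be : {rmorphism B -> B'}).
Hypothesis (ga_f : forall a, ga (f a) = f' (al a)).
Hypothesis (be_g : forall a, be (g a) = g' (al a)).

(** Functoriality of C (x)_A B in the three rings at once. The induced map
    applies ga and be factor by factor; each generator of the relation defining
    the tensor product is sent to a generator of the same kind. *)
Lemma tensor_rel_map s t : tensor_rel f g s t ->
  tensor_rel f' g' [seq (ga x.1, be x.2) | x <- s]
                   [seq (ga x.1, be x.2) | x <- t].
Proof.
elim=> {s t} [s t st|s t _ |s t r _ st _|s s' t t' _ ss' _ tt'|b|c c' b|
  c b b'|c a b] /=.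
- exact/tensor_perm/perm_map.
- exact: tensor_sym.
- exact: tensor_trans.
- by rewrite !map_cat; exact: tensor_cat.
- by rewrite rmorph0; exact: tensor_rel0.
- by rewrite rmorphD; exact: tensor_relDl.
- by rewrite rmorphD; exact: tensor_relDr.
- by rewrite !rmorphM ga_f be_g; exact: tensor_relM.
Qed.

Lemma pi_tensor_map s t : \pi_(tensor f g) s = \pi_(tensor f g) t ->
  \pi_(tensor f' g') [seq (ga x.1, be x.2) | x <- s] =
  \pi_(tensor f' g') [seq (ga x.1, be x.2) | x <- t].
Proof.
by move=> /eqP/tensorP st; apply/eqP/tensorP/tensor_rel_map.
Qed.

Lemma pure_tensor_map c b c' b' :
  pure_tensor f g c b = pure_tensor f g c' b' ->
  pure_tensor f' g' (ga c) (be b) = pure_tensor f' g' (ga c') (be b').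
Proof. exact: pi_tensor_map. Qed.

(** The induced map is unitary, so 1 = 0 in its source forces 1 = 0 in its
    target. *)
Lemma tensor_map_neq0 : (1 : tensor f' g') != 0 -> (1 : tensor f g) != 0.
Proof.
apply: contra_neq => /(@pi_tensor_map [:: (1, 1)] [::]) /=.
by rewrite !rmorph1.
Qed.

End TensorMap.

Section LeftFactor.
Variables (A C B : comPzRingType).
Variables (f : {rmorphism A -> C}) (g : {rmorphism A -> B}).

(** The image of C is a C-submodule, and the elements 1 (x) b span C (x)_A B
    over C, since c (x) b = (c (x) 1)(1 (x) b). *)
Lemma tensor_inl_surj :
    (forall b, exists c, tensor_inl f g c = pure_tensor f g 1 b) ->
  forall z, exists c, tensor_inl f g c = z.
Proof.
move=> surj; elim/quotW; elim=> [|[c b] s [c0 IHs]].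
  by exists 0; rewrite rmorph0.
have [c' c'b] := surj b; exists (c * c' + c0).
rewrite rmorphD rmorphM /= IHs c'b.
rewrite -[LHS]/(tens_add (tens_mul _ _) _) -pi_tens_mul -pi_tens_add.
by rewrite /tens_mulf /= mulr1 mul1r.
Qed.

End LeftFactor.

Section Epimorphism.
Variables (A B : comPzRingType) (u : {rmorphism A -> B}).

(** Multiplication B (x)_A B -> B is a retraction of b |-> b (x) 1, hence is
    bijective if and only if the latter is surjective; that only has to be
    tested on the elements 1 (x) b. *)
Lemma is_epimorphismP : is_epimorphism u <->
  forall b, pure_tensor u u b 1 = pure_tensor u u 1 b.
Proof.
split=> [/bij_inj mult_inj b|swap].
  by apply: mult_inj; rewrite /= !tensor_mult_pi !big_seq1 mulr1 mul1r.
have inlK : cancel (tensor_inl u u) (tensor_mult (u := u)).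
  by move=> b; rewrite /tensor_inl /pure_tensor tensor_mult_pi big_seq1 mulr1.
apply: (bij_can_bij _ inlK); apply: bijective_of_inj_surj.
  exact: can_inj inlK.
by apply: tensor_inl_surj => b; exists b; exact: swap.
Qed.

End Epimorphism.

(** * Inductive limits *)

Section ImageRing.
Variables (d : Order.disp_t) (I : preorderType d).
Hypothesis (I_directed : is_directed I).
Variables (A : ring_system I) (L : comPzRingType).
Variable (phi : forall i : I, {rmorphism A i -> L}).
Hypothesis (phi_cocone : is_cocone phi).

(** The union of the images of the stages, a subring because the index set is
    directed. *)
Definition stage_image : {pred L} :=
  [pred x | `[< exists i a, phi i a = x >]].

Lemma stage_imageP x : reflect (exists i a, phi i a = x) (x \in stage_image).
Proof. exact: asboolP. Qed.

Lemma common_stage i j (a : A i) (b : A j) :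
  exists k a' b', phi k a' = phi i a /\ phi k b' = phi j b.
Proof.
have [_ /(_ i j)[k le_ik le_jk]] := I_directed.
exists k, (transition A le_ik a), (transition A le_jk b).
by rewrite !phi_cocone.
Qed.

Lemma stage_image_closed : subring_closed stage_image.
Proof.
split=> [|_ _ /stage_imageP[i [a <-]] /stage_imageP[j [b <-]]
         |_ _ /stage_imageP[i [a <-]] /stage_imageP[j [b <-]]].
- have [[i] _] := I_directed.
  by apply/stage_imageP; exists i, 1; rewrite rmorph1.
- have [k [a' [b' [<- <-]]]] := common_stage a b.
  by apply/stage_imageP; exists k, (a' - b'); rewrite rmorphB.
- have [k [a' [b' [<- <-]]]] := common_stage a b.
  by apply/stage_imageP; exists k, (a' * b'); rewrite rmorphM.
Qed.

Definition stage_ring := {x : L | x \in stage_image}.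
HB.instance Definition _ := SubChoice.on stage_ring.
HB.instance Definition _ := GRing.SubChoice_isSubComPzRing.Build L _ stage_ring
  stage_image_closed.

Lemma mem_stage_image i a : phi i a \in stage_image.
Proof. by apply/stage_imageP; exists i, a. Qed.

Definition to_stage_ring i (a : A i) : stage_ring :=
  exist _ (phi i a) (mem_stage_image a).

Lemma to_stage_ring_is_zmod_morphism i : zmod_morphism (@to_stage_ring i).
Proof. by move=> a b; apply: val_inj; rewrite /= rmorphB. Qed.

Lemma to_stage_ring_is_monoid_morphism i : monoid_morphism (@to_stage_ring i).
Proof.
by split=> [|a b]; apply: val_inj; rewrite /= ?rmorph1 ?rmorphM.
Qed.

HB.instance Definition _ i := GRing.isZmodMorphism.Build (A i) stage_ring
  (@to_stage_ring i) (@to_stage_ring_is_zmod_morphism i).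
HB.instance Definition _ i := GRing.isMonoidMorphism.Build (A i) stage_ring
  (@to_stage_ring i) (@to_stage_ring_is_monoid_morphism i).

(** The cocone corestricts to the subring of elements coming from a stage, which
    gives a morphism h from L to that subring. Composed with the inclusion it
    is an endomorphism of L compatible with the cocone, hence the identity by
    uniqueness. *)
Lemma limit_covered : is_inductive_limit phi ->
  forall x : L, exists i a, phi i a = x.
Proof.
move=> [_ univ] x; apply/stage_imageP.
have corestr_cocone :
    is_cocone (fun i => @to_stage_ring i : {rmorphism A i -> stage_ring}).
  by move=> i j le_ij a; apply: val_inj; rewrite /= phi_cocone.
have [h [h_phi _]] := univ _ _ corestr_cocone.
have [h0 [_ h0_uniq]] := univ _ _ phi_cocone.
have -> : x = val (h x); last exact: valP.
transitivity (h0 x); first by rewrite -(h0_uniq idfun).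
apply/esym/(h0_uniq (val \o h : {rmorphism L -> L})) => i a /=.
by rewrite h_phi.
Qed.

End ImageRing.

Section Limit.
Variables (d : Order.disp_t) (I : preorderType d).
Hypothesis (I_directed : is_directed I).
Variables (A B : ring_system I) (u : forall i : I, {rmorphism A i -> B i}).
Variables (L M : comPzRingType).
Variable (phi : forall i : I, {rmorphism A i -> L}).
Variable (psi : forall i : I, {rmorphism B i -> M}).
Hypothesis (psi_limit : is_inductive_limit psi).
Variable (v : {rmorphism L -> M}).
Hypothesis (v_limit : is_limit_morphism u phi psi v).

Let psi_covered := limit_covered I_directed psi_limit.1 psi_limit.

(** The contraction of a v-prime ideal J to B_i is u_i-prime, because v is
    compatible with u_i: an element u_i(a) b of the contraction maps to
    v(phi_i(a)) psi_i(b) in J. *)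
Lemma limit_PSI : (forall i, is_PSI (u i)) -> is_PSI v.
Proof.
move=> u_PSI J [J_proper J_v]; split=> // x y.
have [i0 [x0 <-]] := psi_covered x; have [j0 [y0 <-]] := psi_covered y.
have [i [a [b [<- <-]]]] := common_stage I_directed psi_limit.1 x0 y0.
have [|_ J_prime] := u_PSI i [pred z | psi i z \in J]; last first.
  by rewrite -rmorphM; exact: J_prime.
split=> [|a' b']; first exact: proper_ideal_preim.
by rewrite !inE rmorphM -v_limit; exact: J_v.
Qed.

(** Surjectivity of k(P) -> k(P) (x) M is inherited from the stages;
    injectivity holds because the source is a field and the target is not the
    zero ring. *)
Lemma limit_strong_PSI : (forall i, is_strong_PSI (u i)) -> is_strong_PSI v.
Proof.
move=> u_PSI P nz; apply: bijective_of_inj_surj.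
  apply: raddf_inj => c c0; apply/eqP; apply: contraNT nz.
  move=> /residue_field_inv[c' cc'].
  by rewrite -(rmorph1 (tensor_inl (to_residue_field P) v)) -cc' rmorphM c0
     mul0r.
apply: tensor_inl_surj => m; have [i [b <-]] := psi_covered m.
pose r := residue_map (f := phi i) (P := P).
have r_A a : r (to_residue_field _ a) = to_residue_field P (phi i a).
  exact: residue_map_to_residue_field.
have psi_u a : psi i (u i a) = v (phi i a) by rewrite v_limit.
have [inv _ invK] := u_PSI i _ (tensor_map_neq0 r_A psi_u nz).
have [c cb] : exists c, tensor_inl _ (u i) c =
    pure_tensor (to_residue_field (Spec_map (phi i) P)) (u i) 1 b.
  by eexists; exact: invK.
exists (r c); have := pure_tensor_map r_A psi_u cb.
by rewrite !rmorph1.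
Qed.

Lemma limit_epimorphism :
  (forall i, is_epimorphism (u i)) -> is_epimorphism v.
Proof.
move=> u_epi; apply/is_epimorphismP => m; have [i [b <-]] := psi_covered m.
have psi_u a : psi i (u i a) = v (phi i a) by rewrite v_limit.
have := pure_tensor_map psi_u psi_u ((is_epimorphismP (u i)).1 (u_epi i) b).
by rewrite !rmorph1.
Qed.

End Limit.

Theorem proposition3p10 (d : Order.disp_t) (I : preorderType d)
    (I_directed : is_directed I)
    (A B : ring_system I) (u : forall i : I, {rmorphism A i -> B i})
    (u_morphism : is_system_morphism u)
    (L M : comPzRingType)
    (phi : forall i : I, {rmorphism A i -> L})
    (phi_limit : is_inductive_limit phi)
    (psi : forall i : I, {rmorphism B i -> M})
    (psi_limit : is_inductive_limit psi)
    (v : {rmorphism L -> M}) (v_limit : is_limit_morphism u phi psi v) :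
  [/\ (forall i : I, is_PSI (u i)) -> is_PSI v,
      (forall i : I, is_strong_PSI (u i)) -> is_strong_PSI v &
      (forall i : I, is_epimorphism (u i)) -> is_epimorphism v].
Proof.
split.
- exact: (limit_PSI I_directed psi_limit v_limit).
- exact: (limit_strong_PSI I_directed psi_limit v_limit).
- exact: (limit_epimorphism I_directed psi_limit v_limit).
Qed.
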